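(* Let $X$ be a measurable space, $\nu = (\nu_N)_{N\in\mathbb{N}}$ a measure sequence on $X$, and $f : X \to [0,\infty[$ a bounded measurable function. Let $\mathcal{F}_\nu$ be the filter on $X$ generated by all measurable subsets of $X$ of $\nu$-density $1$. Then the following are equivalent: (i) $\lim_{N\to\infty} \int_X f(x)\,\nu_N(\mathrm{d}x) = 0$; (ii) $\mathcal{F}_\nu\text{-}\lim_x f(x) = 0$.
   Context: A measure sequence $\nu = (\nu_N)_{N\in\mathbb{N}}$ on a measurable space $X$ is a sequence of probability measures $\nu_N$ on $X$. For a measurable subset $J \subseteq X$, the density of $J$ with respect to $\nu$ is $\mathrm{d}_\nu(J) := \lim_{N\to\infty} \nu_N(J)$ if this limit exists. The filter $\mathcal{F}_\nu$ is the filter on $X$ generated by all (measurable) subsets of $X$ with $\nu$-density $1$. If $\mathcal{F}$ is a filter on a set $I$ and $f : I \to Y$ is a map into a topological space, $\mathcal{F}\text{-}\lim_i f(i)$ denotes the element $y\in Y$ such that for every neighborhood $U$ of $y$ there is a set $F \in \mathcal{F}$ with $f(i)\in U$ for every $i \in F$ (provided such $y$ exists and is unique). *)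

(* Defs.v *)
From mathcomp Require Import all_boot all_order all_algebra.
From mathcomp Require Import all_classical all_reals all_analysis.

Set Implicit Arguments.
Unset Strict Implicit.
Unset Printing Implicit Defensive.

Import Order.TTheory GRing.Theory Num.Theory.
Import numFieldNormedType.Exports.
Local Open Scope classical_set_scope.
Local Open Scope ring_scope.

Definition has_density d (X : measurableType d) (R : realType)
    (nu : nat -> probability X R) (J : set X) (a : R) : Prop :=
  measurable J /\ nu N J @[N --> \oo] --> a%:E.

(* [smallest Filter G] is the intersection of all filters containing G. *)
Definition density_filter d (X : measurableType d) (R : realType)
    (nu : nat -> probability X R) : set_system X :=
  smallest Filter [set J | has_density nu J 1].

(* "F-lim_i f(i) = y": f tends to y along F, and to no other point. *)
Definition filter_lim_is (I : Type) (Y : topologicalType) (F : set_system I)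
    (f : I -> Y) (y : Y) : Prop :=
  unique (fun z : Y => f i @[i --> F] --> z) y.

(* Main.v *)
Require Import Defs.
From mathcomp Require Import all_boot all_order all_algebra.
From mathcomp Require Import all_classical all_reals all_analysis.
From mathcomp Require Import measurable_realfun.

(** Both conditions are equivalent to the assertion that, for each [e > 0], the
    sublevel set of the points where [f < e] has density [1]; in other words,
    that its complement [f >= e] has asymptotic mass [0].

    For (ii): the density-one sets are closed under finite intersection
    (their complements are asymptotically null, and measures are subadditive),
    so the filter that they generate consists of the supersets of density-one
    sets ([density_filterE]). A measurable member of the filter then has itself
    density [1] ([density_filterP]), which turns convergence of [f] to [0] into
    the statement on sublevel sets ([cvg_density_filter0P]). The filter is
    proper, because the empty set has density [0]; as the line is Hausdorff, a
    limit along the filter is automatically unique.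

    For (i): with [e > 0], and with [M >= 0] a bound of [f], the integral of [f]
    against each [nu N] lies between [e * nu N (f >= e)], by Markov's inequality
    ([markov_ge0]), and [e + M * nu N (f >= e)], by splitting the integral along
    the sublevel set ([integral_le_split]). By the lower bound, the integrals
    can only vanish in the limit if the mass of [f >= e] does. Conversely, if
    that mass vanishes for every [e], the upper bound makes the integrals
    eventually smaller than any number above [e], and [e] is arbitrary. *)

Import Order.TTheory GRing.Theory Num.Theory.
Import numFieldNormedType.Exports.
Local Open Scope classical_set_scope.
Local Open Scope ring_scope.

(** A single bound makes a nonnegative [u] eventually finite, after which this is
    convergence of the real parts. *)
Lemma cvge0P (R : realFieldType) (I : Type) (F : set_system I) (FF : Filter F)
    (u : I -> \bar R) (u_ge0 : forall i, (0 <= u i)%E) :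
  u i @[i --> F] --> 0%E <->
  forall e : R, 0 < e -> \forall i \near F, (u i <= e%:E)%E.
Proof.
split=> [u0 e e0|H].
  have H := @nbhs_open_ereal_lt R 0 (fun=> e) e0.
  have : \forall i \near F, (u i < e%:E)%E := u0 _ H.
  by apply: filterS => i /ltW.
apply/fine_cvgP; split.
  apply: (filterS _ (H 1 ltr01)) => i ui.
  by rewrite ge0_fin_numE // (le_lt_trans ui) ?ltry.
apply/cvgr0Pnorm_le => e e0.
apply: (filterS _ (H e e0)) => i ui /=.
rewrite ger0_norm ?fine_ge0 // -lee_fin fineK //.
by rewrite ge0_fin_numE // (le_lt_trans ui) ?ltry.
Qed.

Section density_one.
Context {R : realType} {d : measure_display} {X : measurableType d}.
Variable nu : nat -> probability X R.

(** Null complements are easier to handle than full sets: bounds on their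
    measure only need monotonicity and subadditivity. *)
Lemma has_density1P (J : set X) (mJ : measurable J) :
  has_density nu J 1 <-> nu N (~` J) @[N --> \oo] --> 0%E.
Proof.
split=> [[_ J1]|J0]; last split=> //.
- have -> : (fun N => nu N (~` J)) = (fun N => 1 - nu N J)%E.
    by apply/funext => N; rewrite probability_setC.
  by rewrite -(@subee _ 1%E) //; apply: cvgeB => //; exact: cvg_cst.
- have -> : (fun N => nu N J) = (fun N => 1 - nu N (~` J))%E.
    apply/funext => N; rewrite -probability_setC ?setCK //.
    exact: measurableC.
  by rewrite -[X in _ --> X]sube0; apply: cvgeB => //; exact: cvg_cst.
Qed.

Lemma has_density1S (J K : set X) (mK : measurable K) :
  J `<=` K -> has_density nu J 1 -> has_density nu K 1.
Proof.
move=> JK J1; have mJ := J1.1.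
apply/has_density1P => //; move/(has_density1P _ mJ): J1 => J0.
apply: (squeeze_cvge _ (cvg_cst 0%E) J0).
apply: nearW => N; rewrite measure_ge0 /=.
by apply: le_measure; rewrite ?inE; [exact: measurableC..|exact: subsetC].
Qed.

Lemma has_density1I (J K : set X) :
  has_density nu J 1 -> has_density nu K 1 -> has_density nu (J `&` K) 1.
Proof.
move=> J1 K1; have mJ := J1.1; have mK := K1.1.
apply/has_density1P; first exact: measurableI.
move/(has_density1P _ mJ): J1 => J0; move/(has_density1P _ mK): K1 => K0.
have JK0 : (nu N (~` J) + nu N (~` K))%E @[N --> \oo] --> 0%E.
  by rewrite -[0%E]adde0; exact: cvgeD.
apply: (squeeze_cvge _ (cvg_cst 0%E) JK0).
apply: nearW => N; rewrite measure_ge0 /= setCI.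
by apply: measureU2; exact: measurableC.
Qed.

Lemma has_density1T : has_density nu setT 1.
Proof.
apply/has_density1P => //; rewrite setCT.
by under eq_fun do rewrite measure0; exact: cvg_cst.
Qed.

(** Stability of density one under finite intersection makes the supersets of
    density-one sets a filter, which is then the smallest one. *)
Lemma density_filterE :
  density_filter nu = filter_from [set J | has_density nu J 1] id.
Proof.
rewrite /density_filter; apply/seteqP; split.
- apply: smallest_sub => [|J J1]; last by exists J.
  apply: filter_from_filter; first by exists setT; exact: has_density1T.
  by move=> J K J1 K1; exists (J `&` K) => //; exact: has_density1I.
- move=> A [J J1 JA].
  have FF := @smallest_filter_filter _ [set J | has_density nu J 1].
  by apply: (@filterS _ _ FF _ _ JA); exact: sub_gen_smallest.
Qed.

Lemma density_filterP (A : set X) (mA : measurable A) :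
  density_filter nu A <-> has_density nu A 1.
Proof.
rewrite density_filterE; split=> [[J J1 JA]|A1]; last by exists A.
exact: has_density1S J1.
Qed.

Lemma density_filter_filter : Filter (density_filter nu).
Proof. exact: smallest_filter_filter. Qed.

(** The total mass is [1] for each [nu N], so the empty set is not of density
    one; this is what makes limits along the filter unique. *)
Lemma density_filter_proper : ProperFilter (density_filter nu).
Proof.
have FF := density_filter_filter.
apply: Build_ProperFilter; move=> /(density_filterP _ measurable0)[_].
under eq_fun do rewrite measure0.
move=> cvg1; have : 1%E = 0%E :> \bar R.
  exact: (cvg_unique (@ereal_hausdorff R) cvg1 (cvg_cst _)).
by move/eqP; rewrite eqe oner_eq0.
Qed.

End density_one.
Existing Instance density_filter_proper.

Section sublevel.
Context {R : realType} {d : measure_display} {X : measurableType d}.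
Variable f : X -> R.
Hypothesis f_ge0 : forall x, 0 <= f x.
Hypothesis f_meas : measurable_fun setT f.

Lemma measurable_sublevel (e : R) : measurable [set x | f x < e].
Proof.
rewrite -[X in measurable X]setTI.
rewrite (_ : [set x | _] = f @^-1` `]-oo, e[).
  exact: f_meas.
by apply/seteqP; split => x /=; rewrite in_itv.
Qed.

Lemma setC_sublevel (e : R) : ~` [set x | f x < e] = [set x | e <= f x].
Proof. by apply/seteqP; split => x /=; rewrite leNgt => /negP. Qed.

(** The sublevel sets are the preimages of the basic neighborhoods of [0],
    because [f] is nonnegative, and they are measurable, so that belonging to the
    filter amounts to having density one. *)
Lemma cvg_density_filter0P (nu : nat -> probability X R) :
  f x @[x --> density_filter nu] --> 0 <->
  forall e, 0 < e -> has_density nu [set x | f x < e] 1.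
Proof.
split=> [/cvgr0Pnorm_lt f0 e e0|H].
  apply/density_filterP; first exact: measurable_sublevel.
  by apply: (filterS _ (f0 e e0)) => x; rewrite ger0_norm.
apply/cvgr0Pnorm_lt => e e0.
have /density_filterP in_filter := H e e0.
apply: (filterS _ (in_filter (measurable_sublevel e))) => x /=.
by rewrite ger0_norm.
Qed.

Lemma markov_ge0 (mu : probability X R) (e : R) : 0 < e ->
  (e%:E * mu (~` [set x | (f x < e)%R]) <= \int[mu]_x (f x)%:E)%E.
Proof.
move=> e0; rewrite setC_sublevel.
have mf : measurable_fun setT (EFin \o f) by exact/measurable_EFinP.
have := @le_integral_comp_abse _ _ _ mu setT measurableT (EFin \o f) e id
  (@measurable_id _ _ _) (fun _ => id) (fun _ _ _ _ => id) mf e0.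
rewrite setTI => H; apply: le_trans (le_trans H _).
- rewrite le_eqVlt; apply/orP; left; apply/eqP; congr (_ * mu _)%E.
  by apply/seteqP; split => x /=; rewrite lee_fin ger0_norm.
- rewrite le_eqVlt; apply/orP; left; apply/eqP; apply: eq_integral => x _ /=.
  by rewrite ger0_norm.
Qed.

(** On the sublevel set [f] is at most [e] and the mass at most [1]; on the
    complement [f] is at most [M]. *)
Lemma integral_le_split (mu : probability X R) (e M : R) :
  0 <= e -> 0 <= M -> (forall x, f x <= M) ->
  (\int[mu]_x (f x)%:E <= e%:E + M%:E * mu (~` [set x | (f x < e)%R]))%E.
Proof.
move=> e0 M0 fM; set J := [set x | f x < e].
have mJ : measurable J := measurable_sublevel e.
have mJC : measurable (~` J) by exact: measurableC.
have mf D : measurable_fun D (EFin \o f).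
  by apply: measurable_funS (measurableT) _ _ => //; exact/measurable_EFinP.
have bound (D : set X) (c : R) : measurable D -> 0 <= c ->
    (forall x, D x -> f x <= c) ->
    (\int[mu]_(x in D) (f x)%:E <= c%:E * mu D)%E.
  move=> mD c0 fc; rewrite -integral_cst //; apply: ge0_le_integral => //.
  by move=> x /fc; rewrite lee_fin.
rewrite -[X in (\int[_]_(_ in X) _)%E](setUv J) ge0_integral_setU //.
- apply: leeD.
    apply: (le_trans (bound J e mJ e0 _)) => [x /ltW //|].
    rewrite -[leRHS]mule1; apply: lee_wpmul2l; rewrite ?lee_fin //.
    exact: probability_le1.
  exact: bound.
- by move=> x _; rewrite lee_fin.
- by apply/disj_setPCl.
Qed.

End sublevel.

Theorem proposition2p3 (R : realType) (d : measure_display)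
    (X : measurableType d) (nu : nat -> probability X R) (f : X -> R)
    (f_ge0 : forall x, 0 <= f x) (f_bounded : bounded_fun f)
    (f_meas : measurable_fun setT f) :
  ((\int[nu N]_x (f x)%:E)%E @[N --> \oo] --> 0%E) <->
  filter_lim_is (density_filter nu) f 0.
Proof.
have lim0P : filter_lim_is (density_filter nu) f 0 <->
    f x @[x --> density_filter nu] --> 0.
  split=> [[]//|f0]; split=> // z fz.
  exact: (cvg_unique (@norm_hausdorff R R) f0 fz).
rewrite lim0P (cvg_density_filter0P _ f_ge0 f_meas).
have int_ge0 N : (0 <= \int[nu N]_x (f x)%:E)%E.
  by apply: integral_ge0 => x _; rewrite lee_fin.
split=> [int0 e e0|dens].
- apply/has_density1P; first exact: measurable_sublevel.
  have markov_bound : (e^-1%:E * \int[nu N]_x (f x)%:E)%E @[N --> \oo] --> 0%E.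
    by rewrite -[0%E](mule0 e^-1%:E); exact: cvgeZl.
  apply: (squeeze_cvge _ (cvg_cst 0%E) markov_bound).
  apply: nearW => N; rewrite measure_ge0 /=.
  by rewrite lee_pdivlMl // markov_ge0.
- have [M M0 fM] : exists2 M, 0 <= M & forall x, f x <= M.
    have [M [_ fM]] := f_bounded.
    exists (`|M| + 1) => [|x]; first by rewrite addr_ge0.
    apply: le_trans (ler_norm _) _.
    by apply: (fM (`|M| + 1)) => //; rewrite (le_lt_trans (ler_norm _)) ?ltrDl.
  (* The target [e] is halved because the upper bound tends to the level of
     the sublevel set, which must lie strictly below the target. *)
  apply/cvge0P => // e e0; have e20 : 0 < e / 2 by rewrite divr_gt0.
  have J0 : nu N (~` [set x | f x < e / 2]) @[N --> \oo] --> 0%E.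
    by apply/has_density1P; [exact: measurable_sublevel|exact: dens].
  have ub : ((e / 2)%:E + M%:E * nu N (~` [set x | (f x < e / 2)%R]))%E
      @[N --> \oo] --> (e / 2)%:E.
    rewrite -[X in _ --> X]adde0 -(mule0 M%:E).
    by apply: cvgeD => //; [exact: cvg_cst | exact: cvgeZl].
  have lt_e : e / 2 < e by rewrite ltr_pdivrMr // ltr_pMr // ltr1n.
  have near_lt : \forall N \near \oo,
      ((e / 2)%:E + M%:E * nu N (~` [set x | (f x < e / 2)%R]) < e%:E)%E.
    exact: ub _ (@nbhs_open_ereal_lt R (e / 2) (fun=> e) lt_e).
  apply: (filterS _ near_lt) => N /ltW; apply: le_trans.
  exact: integral_le_split (ltW e20) M0 fM.
Qed.
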